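(* Let $G$ and $H$ be simple $3$-connected graphs such that $G$ has a proper $H$-minor, but $G$ has no $H$-deletable edges. Then there exists a simple $3$-connected graph $G'$ with an $H$-minor, but with no $H$-deletable edges, such that one of the following holds: (a) $G' = G/f$ for some edge $f$ of $G$; (b) $G' = G/f\backslash e$, where $e$ and $f$ are edges of $G$ incident to a (common) degree $3$ vertex in $G$; or (c) $G' = G - w$, where $w$ is a degree $3$ vertex in $G$. Moreover, $|V(G')| = |V(G)|-1$ and $|E(G')| \ge |E(G)|-3$.
   Context: Graphs are finite and may have loops and multiple edges; a graph is simple if it has none. A graph with at least 4 vertices is $3$-connected if at least 3 vertices must be removed to disconnect it; by convention $K_4$ is $3$-connected. $G\backslash e$ denotes the graph obtained from $G$ by deleting the edge $e$ (keeping its end vertices). $G/f$ denotes the graph obtained by contracting the edge $f$: its two end vertices are identified to one vertex and the loop formed from $f$ is deleted (parallel edges may arise and are not removed). $G-w$ denotes deletion of the vertex $w$ with all incident edges. $H$ is a minor of $G$ if $H$ can be obtained from $G$ by deleting or contracting edges; $G$ has an $H$-minor if it has a minor isomorphic to $H$, and the $H$-minor is proper if $G\not\cong H$. For a $3$-connected graph $G$ with an $H$-minor, an edge $e$ of $G$ is called $H$-deletable if $G\backslash e$ is $3$-connected and has an $H$-minor. *)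

(* Defs.v *)
From mathcomp Require Import all_boot.

Set Implicit Arguments.
Unset Strict Implicit.
Unset Printing Implicit Defensive.

(* Finite multigraphs: an edge has one end if it is a loop and two otherwise,
   and distinct edges may have the same set of ends. *)
Record mgraph := MGraph {
  vertex : finType;
  edge : finType;
  ends : edge -> {set vertex};
  ends_card : forall e, 0 < #|ends e| <= 2 }.

Definition simple_graph (G : mgraph) : Prop :=
  (forall e : edge G, #|ends e| = 2) /\ injective (@ends G).

(* A loop contributes 2 to the degree. *)
Definition degree (G : mgraph) (v : vertex G) : nat :=
  #|[set e : edge G | v \in ends e]| + #|[set e : edge G | ends e == [set v]]|.

Definition isomorphic (G H : mgraph) : Prop :=
  exists (fV : vertex G -> vertex H) (fE : edge G -> edge H),
    [/\ bijective fV, bijective fE & forall e, ends (fE e) = fV @: ends e].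

Section Operations.

Variable G : mgraph.

Section DeleteEdge.

Variable e : edge G.

Definition delete_ends (x : {x : edge G | x != e}) : {set vertex G} :=
  ends (val x).

Fact delete_ends_card x : 0 < #|delete_ends x| <= 2.
Proof. exact: ends_card. Qed.

Definition delete : mgraph := MGraph delete_ends_card.

End DeleteEdge.

Section Contract.

Variable f : edge G.

(* The vertex None is the one obtained by identifying the ends of f:
   insub sends the ends of f to None and any other vertex v to Some v. *)
Definition contract_vertex (v : vertex G) :
  option {v : vertex G | v \notin ends f} := insub v.

Definition contract_ends (x : {x : edge G | x != f}) :
  {set option {v : vertex G | v \notin ends f}} :=
  contract_vertex @: ends (val x).

Fact contract_ends_card x : 0 < #|contract_ends x| <= 2.
Proof.
have /andP[x_gt0 x_le2] := ends_card (val x).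
rewrite (leq_trans (leq_imset_card _ _) x_le2) andbT.
have /card_gt0P[v vx] := x_gt0.
by apply/card_gt0P; exists (contract_vertex v); apply: imset_f.
Qed.

Definition contract : mgraph := MGraph contract_ends_card.

End Contract.

Section DeleteVertices.

Variable S : {set vertex G}.

Definition delete_vertices_ends (x : {x : edge G | [disjoint ends x & S]}) :
  {set {v : vertex G | v \notin S}} := val @^-1: ends (val x).

Fact delete_vertices_ends_card x : 0 < #|delete_vertices_ends x| <= 2.
Proof.
rewrite -(card_imset _ val_inj).
suff -> : val @: delete_vertices_ends x = ends (val x) by exact: ends_card.
apply/setP => v; apply/imsetP/idP => [[u + ->]|vx]; first by rewrite inE.
have vS : v \notin S by rewrite (disjointFr (valP x) vx).
by exists (Sub v vS); rewrite ?inE SubK.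
Qed.

Definition delete_vertices : mgraph := MGraph delete_vertices_ends_card.

End DeleteVertices.

Definition delete_vertex (w : vertex G) : mgraph := delete_vertices [set w].

Definition adjacent : rel (vertex G) :=
  fun x y => [exists e : edge G, ends e == [set x; y]].

Definition connected : Prop := forall x y : vertex G, connect adjacent x y.

End Operations.

(* No set of vertices disconnects a complete graph, so K_4 is 3-connected. *)
Definition three_connected (G : mgraph) : Prop :=
  4 <= #|vertex G| /\
  forall S : {set vertex G}, ~ connected (delete_vertices S) -> 3 <= #|S|.

Inductive minor (M : mgraph) : mgraph -> Prop :=
| minor_refl : minor M M
| minor_delete (G : mgraph) (e : edge G) : minor M (delete e) -> minor M G
| minor_contract (G : mgraph) (f : edge G) : minor M (contract f) -> minor M G.

Definition has_minor (G H : mgraph) : Prop :=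
  exists M : mgraph, minor M G /\ isomorphic M H.

Definition has_proper_minor (G H : mgraph) : Prop :=
  has_minor G H /\ ~ isomorphic G H.

Definition deletable (H G : mgraph) (e : edge G) : Prop :=
  three_connected (delete e) /\ has_minor (delete e) H.

(* Main.v *)
Require Import Defs.
From mathcomp Require Import all_boot.
From mathcomp Require Import zify.
From Stdlib Require Import Classical.

(** A minor is handled as a branch map: a surjection phi from V(G) to V(H) whose
    fibers are connected and which hits every edge of H.  As H is simple, such a
    map exists exactly when G has an H-minor, and both this and 3-connectivity
    depend on the adjacency relation alone.  So most arguments are about
    relations, and loops and parallel edges matter only when edges are counted.

    The heart is the lemma contractible_edge: some edge f has G/f 3-connected
    with an H-minor.  First, phi is not injective, for otherwise H is a spanning
    subgraph of G other than G, and any edge of G outside H is H-deletable.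
    So some edge xy lies in a fiber, and contracting it keeps the minor.  If G/xy is not
    3-connected, then {x,y,z} separates G for some z.  The cut meets at most two
    fibers, hence by 3-connectivity of H one side D lies in the fibers of x and
    z.  All of D can be reassigned to one of these two fibers, as chosen,
    because every vertex of D reaches each of x, y, z inside D.  Hence
    contracting any edge that touches D keeps the minor.  It remains to find
    among those edges one whose contraction is 3-connected.  This is Thomassen's
    argument: take u in D adjacent to z; if G/zu is not 3-connected then zu lies
    in a 3-cut, one side of which misses the adjacent vertices x and y, and that
    side meets D in a smaller set of the same kind.

    Next, if e is an edge such that G/f\e is 3-connected with an H-minor, then
    G\e has the minor too, so it is not 3-connected.  A cut of G\e by at most two
    vertices must disappear when f is contracted, so one of its sides is a single
    vertex w, which then is an end of both e and f and has degree 3 in G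
    (contract_delete_degree3).

    The theorem follows by deleting from G/f until nothing is deletable.  If G/f
    has two parallel edges, they come from a triangle xyz with f = xy; either
    may be deleted, so x and y have degree 3, and after one deletion the merged
    vertex has degree 3, which blocks any further one: outcome (b).  If G/f is
    simple, either nothing is deletable (a), or one edge e at an end w of f is,
    where w has degree 3.  A second deletable edge e' must also be at w, as
    otherwise the other end of f has degree 3 and the merged vertex is left with
    degree 2.  Then G/f\e\e' is G-w.  A third would force the other end of f to
    have degree 3 in G, hence degree 2 in G-w, contradicting 3-connectivity:
    outcome (c). *)

Set Implicit Arguments.
Unset Strict Implicit.
Unset Printing Implicit Defensive.

(** * Branch maps *)

Lemma connect_map (T U : finType) (r : rel T) (s : rel U) (f : T -> U) :
    (forall u v, r u v -> connect s (f u) (f v)) ->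
  forall u v, connect r u v -> connect s (f u) (f v).
Proof.
move=> rs u v /connectP[p + ->]; elim: p u => [|w p IHp] u //= /andP[ruw pw].
exact: connect_trans (rs _ _ ruw) (IHp _ pw).
Qed.

Definition fiber_rel (T U : finType) (r : rel T) (phi : T -> U) : rel T :=
  fun u v => r u v && (phi u == phi v).

(** The fibers of phi are the branch sets, so that a branch set is never empty
    and every vertex of T is in one.  Loops of s are left out, as a
    minor without loops never uses them. *)
Record model (T U : finType) (r : rel T) (s : rel U) (phi : T -> U) : Prop :=
  Model {
    model_onto : forall h, exists v, phi v = h;
    model_fiber : forall p q, phi p = phi q -> connect (fiber_rel r phi) p q;
    model_edge : forall h k, s h k -> h != k ->
      exists u v, [/\ r u v, phi u = h & phi v = k] }.

(** Minors compose: a path through fibers of phi lifts along pi by joining the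
    endpoints of consecutive lifted edges inside the connected fibers of pi. *)
Lemma model_comp (T U W : finType) (r : rel T) (s : rel U) (t : rel W) pi phi :
  model r s pi -> model s t phi -> model r t (phi \o pi).
Proof.
move=> [pi_onto pi_fib pi_edge] [phi_onto phi_fib phi_edge]; split.
- by move=> h; have [a <-] := phi_onto h; have [v <-] := pi_onto a; exists v.
- have lift p q : pi p = pi q -> connect (fiber_rel r (phi \o pi)) p q.
    move=> /pi_fib; apply: connect_sub => u v /andP[ruv /eqP uv].
    by apply: connect1; rewrite /fiber_rel ruv /= uv eqxx.
  move=> p q /= /phi_fib /connectP[l].
  elim: l p => [|c l IHl] p /=; first by move=> _ /esym /lift.
  move=> /andP[/andP[pc ppc] lc] ql.
  have [pcE|npc] := eqVneq (pi p) c.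
    by apply: (IHl p); rewrite pcE.
  have [u [v [ruv pu pv]]] := pi_edge _ _ pc npc.
  apply: connect_trans (lift p u (esym pu)) _.
  apply: (connect_trans (y := v)).
    by apply: connect1; rewrite /fiber_rel ruv /= pu pv.
  by apply: IHl; rewrite pv.
- move=> h k hk nhk; have [a [b [sab ah bk]]] := phi_edge _ _ hk nhk.
  have nab : a != b by apply: contraNneq nhk => ab; rewrite -ah -bk ab.
  have [u [v [ruv ua vb]]] := pi_edge _ _ sab nab.
  by exists u, v; split=> //=; rewrite ?ua ?vb.
Qed.

Lemma model_eq (T U : finType) (r : rel T) (s : rel U) phi psi :
  phi =1 psi -> model r s phi -> model r s psi.
Proof.
move=> E [onto fib edg]; split.
- by move=> h; have [v <-] := onto h; exists v; rewrite E.
- move=> p q; rewrite -!E => /fib; apply: connect_sub => u v uv.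
  by apply: connect1; rewrite /fiber_rel -!E.
- move=> h k hk nhk; have [u [v [uv <- <-]]] := edg h k hk nhk.
  by exists u, v; rewrite !E.
Qed.

(** Loops are disregarded, so that contracting an edge is such a map. *)
Definition weak_hom (T U : finType) (r : rel T) (s : rel U) (pi : T -> U) : Prop :=
  forall u v, r u v -> pi u = pi v \/ s (pi u) (pi v).

(** A model that is constant on the fibers of pi descends to the quotient.  With
    pi = id this is monotonicity of minors under adding edges. *)
Lemma model_push (T U W : finType) (r : rel T) (s : rel U) (t : rel W) pi phi :
  weak_hom r s pi -> (forall a, exists v, pi v = a) ->
  model r t (phi \o pi) -> model s t phi.
Proof.
move=> homp onto [m_onto m_fib m_edge]; split.
- by move=> h; have [v <-] := m_onto h; exists (pi v).
- move=> a b; have [p <-] := onto a; have [q <-] := onto b.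
  move=> /m_fib; apply: connect_map => u v /andP[/homp[->//|suv] /eqP uv].
  by apply: connect1; rewrite /fiber_rel suv; apply/eqP.
- move=> h k hk nhk; have [u [v [/homp[uv|suv] uh vk]]] := m_edge _ _ hk nhk.
    by case/eqP: nhk; rewrite -uh -vk /= uv.
  by exists (pi u), (pi v).
Qed.

(** * Separations and 3-connectivity of a relation *)

(** The vertices outside D and S form the other side, so it is enough to say
    that no edge leaves D except into S. *)
Record separation (T : finType) (r : rel T) (D S : {set T}) : Prop :=
  Separation {
    sep_in : exists d, d \in D;
    sep_out : exists e, (e \notin D) && (e \notin S);
    sep_disj : forall d, d \in D -> d \notin S;
    sep_edge : forall u v, u \in D -> r u v -> (v \in D) || (v \in S) }.

(** Separations, unlike the induced subgraphs in the definition of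
    3-connectivity, pull back along maps between vertex sets. *)
Definition conn3 (T : finType) (r : rel T) : Prop :=
  4 <= #|T| /\ forall D S, separation r D S -> 3 <= #|S|.

Lemma separation_compl (T : finType) (r : rel T) (D S : {set T}) :
  symmetric r -> separation r D S -> separation r (~: (D :|: S)) S.
Proof.
move=> rsym [[d dD] [e /andP[eD eS]] DS DE]; split.
- by exists e; rewrite !inE negb_or eD.
- by exists d; rewrite !inE dD (DS d dD).
- by move=> v; rewrite !inE => /norP[].
- move=> u v; rewrite !inE => /norP[uD uS] ruv.
  case: (boolP (v \in S)) => vS; rewrite ?orbT // !orbF.
  apply: contra uD => vD; move: (DE v u vD); rewrite rsym ruv (negPf uS) orbF.
  exact.
Qed.

Lemma separation_preim (T U : finType) (r : rel T) (s : rel U) (pi : T -> U) D S :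
  weak_hom r s pi -> (forall a, exists v, pi v = a) ->
  separation s D S -> separation r (pi @^-1: D) (pi @^-1: S).
Proof.
move=> homp onto [[d dD] [e eDS] DS DE]; split.
- by have [v vd] := onto d; exists v; rewrite inE vd.
- by have [v ve] := onto e; exists v; rewrite !inE ve.
- by move=> v; rewrite !inE; apply: DS.
- move=> u v; rewrite !inE => uD /homp[<-|]; first by rewrite uD.
  exact: DE.
Qed.

Lemma conn3_bij (T U : finType) (r : rel T) (s : rel U) (pi : T -> U) :
  bijective pi -> weak_hom r s pi -> conn3 r -> conn3 s.
Proof.
move=> pib homp [T4 cr]; split; first by rewrite -(bij_eq_card pib).
move=> D S sDS; have [ip piK ipK] := pib.
have -> : #|S| = #|pi @^-1: S|.
  by rewrite on_card_preimset //; apply: onW_bij.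
apply: (cr (pi @^-1: D)); apply: separation_preim homp _ sDS => a.
by exists (ip a).
Qed.

(** A vertex of S with no neighbour in D could be dropped from S, leaving a
    separator with fewer than 3 vertices. *)
Lemma separation_boundary (T : finType) (r : rel T) (D S : {set T}) s :
  conn3 r -> separation r D S -> #|S| <= 3 -> s \in S ->
  exists2 d, d \in D & r d s.
Proof.
move=> [_ cr] [Din Dout DS DE] S3 sS.
case: (boolP [exists d in D, r d s]) => [/exists_inP[d dD ds]|/exists_inPn no].
  by exists d.
suff /cr : separation r D (S :\ s) by move: (cardsD1 s S) S3; rewrite sS; lia.
split=> //.
- by have [e /andP[eD eS]] := Dout; exists e; rewrite eD !inE (negPf eS) andbF.
- by move=> d /DS; rewrite !inE negb_and => ->; rewrite orbT.
- move=> u v uD ruv; have := DE u v uD ruv; rewrite !inE.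
  by have [vs|//] := eqVneq v s; case/negP: (no u uD); rewrite -vs.
Qed.

(** The set of vertices that d reaches inside D is itself cut off by S, so every
    vertex of S has a neighbour in it. *)
Lemma separation_reach (T : finType) (r : rel T) (D S : {set T}) s d :
  conn3 r -> separation r D S -> #|S| <= 3 -> s \in S -> d \in D ->
  connect [rel u v | [&& u \in D, r u v & (v \in D) || (v == s)]] d s.
Proof.
move=> cr sD S3 sS dD; have [Din [e /andP[eD eS]] DS DE] := sD.
pose R := [set v in D | connect [rel u v | [&& u \in D, r u v & v \in D]] d v].
have sR : separation r R S.
  split.
  - by exists d; rewrite inE dD connect0.
  - by exists e; rewrite inE (negPf eD).
  - by move=> v; rewrite inE => /andP[/DS].
  - move=> u v; rewrite !inE => /andP[uD du] ruv.
    have := DE u v uD ruv; case: (boolP (v \in D)) => //= vD _.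
    rewrite (connect_trans du) //; apply: connect1 => /=.
    by rewrite uD ruv.
have [b + bs] := separation_boundary cr sR S3 sS.
rewrite inE => /andP[bD db]; apply: (connect_trans (y := b)).
  apply: connect_sub db => u v /and3P[uD uv vD].
  by apply: connect1; rewrite /= uD uv vD.
by apply: connect1; rewrite /= bD bs eqxx orbT.
Qed.

(** * Moving a model off one side of a 3-separation *)

(** A fiber that misses S is connected and so lies on one side.  If both sides
    contained such a fiber, the image of S would separate s with at most two
    vertices. *)
Lemma model_side (T U : finType) (r : rel T) (s : rel U) phi D S :
  conn3 s -> model r s phi -> separation r D S -> #|phi @: S| <= 2 ->
  (forall d, d \in D -> phi d \in phi @: S) \/
  (forall e, e \notin D -> e \notin S -> phi e \in phi @: S).
Proof.
move=> [_ cs] [onto fib edg] [_ _ DS DE] S2.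
have stay p q : phi p = phi q -> phi p \notin phi @: S -> p \in D -> q \in D.
  move=> /fib /connectP[l + ->]; elim: l p => [|c l IHl] p //=.
  move=> /andP[/andP[pc /eqP ppc] lc] pS pD; apply: IHl => //.
    by rewrite -ppc.
  have /orP[//|cS] := DE p c pD pc.
  by case/negP: pS; rewrite ppc imset_f.
case: (boolP [exists d in D, phi d \notin phi @: S]) => [|/exists_inPn no]; last first.
  by left=> d dD; have := no d dD; rewrite negbK.
move=> /exists_inP[d dD dS]; right=> e eD eS; apply/negPn/negP => peS.
suff /cs : separation s [set h in ~: phi @: S | [exists v in D, phi v == h]] (phi @: S).
  by rewrite ltnNge S2.
split.
- by exists (phi d); rewrite !inE dS; apply/exists_inP; exists d.
- exists (phi e); rewrite peS andbT !inE peS /=; apply/exists_inPn => v vD.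
  apply: contra eD => /eqP ve; apply: (stay v) => //; by rewrite ve.
- by move=> h; rewrite !inE => /andP[].
- move=> h k; rewrite !inE => /andP[hS /exists_inP[v vD /eqP vh]] hk.
  have [<-|nhk] := eqVneq h k.
    by rewrite hS; apply/orP; left; apply/exists_inP; exists v; rewrite ?vh.
  have [a [b [ab ah bk]]] := edg _ _ hk nhk.
  case: (boolP (k \in phi @: S)) => kS; rewrite ?orbT ?orbF //=.
  have aD : a \in D by apply: (stay v); rewrite ?vh.
  have /orP[bD|bS] := DE a b aD ab.
    by apply/exists_inP; exists b; rewrite ?bk.
  by case/negP: kS; rewrite -bk imset_f.
Qed.

(** This is why contracting an edge dw at D keeps the minor: all of D is handed
    over to a single fiber, chosen so that it contains w.  The rest of each
    fiber stays connected since x and y are adjacent and a detour through D can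
    enter and leave only at the cut, and D still touches every cut vertex. *)
Lemma model_reroute (T U : finType) (r : rel T) (s : rel U) phi D x y z d w :
  symmetric r -> conn3 r -> model r s phi -> separation r D [set x; y; z] ->
  r x y -> phi x = phi y ->
  (forall v, v \in D -> phi v \in phi @: [set x; y; z]) ->
  d \in D -> r d w ->
  exists2 psi, model r s psi & psi d = psi w.
Proof.
set S := [set x; y; z] => rsym cr [onto fib edg] sD rxy pxy DpS dD rdw.
have [_ _ DS DE] := sD.
have S3 : #|S| <= 3 by rewrite /S setUC cardsU1 cards2; lia.
have xS : x \in S by rewrite !inE eqxx.
have yS : y \in S by rewrite !inE eqxx !orbT.
have zS : z \in S by rewrite !inE eqxx !orbT.
have SE v : v \in S -> phi v = phi x \/ v = z.
  by rewrite !inE -orbA => /or3P[]/eqP->; [left|left|right].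
(* The fiber that takes over D; it must contain w when w lies in the cut. *)
pose t := if w \in D then x else w.
have tS : t \in S.
  rewrite /t; case: ifPn => // wD; have := DE d w dD rdw; by rewrite (negPf wD).
have nDS v : v \in S -> (v \in D) = false.
  by move=> vS; apply/negP => /DS; rewrite vS.
pose psi v := if v \in D then phi t else phi v.
have psiS v : v \in S -> psi v = phi v by move=> vS; rewrite /psi nDS.
exists psi; last first.
  by rewrite /psi dD /t; case: ifP.
have fsym : connect_sym (fiber_rel r psi).
  apply: sym_connect_sym => u v; by rewrite /fiber_rel rsym eq_sym.
have reach v a : v \in D -> a \in S -> phi a = phi t ->
    connect (fiber_rel r psi) v a.
  move=> vD aS at_; have := separation_reach cr sD S3 aS vD.
  apply: connect_sub => b c /= /and3P[bD bc bca]; apply: connect1.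
  rewrite /fiber_rel bc /= /psi bD; case/orP: bca => [->//|/eqP->].
  by rewrite nDS // at_.
have toX v : v \in S -> phi v = phi x -> connect (fiber_rel r psi) v x.
  move=> vS vx; have [tx|tx] := eqVneq (phi t) (phi x).
    have [a aD _] := separation_boundary cr sD S3 xS.
    apply: (connect_trans (y := a)); last exact: reach.
    by rewrite fsym; apply: reach => //; rewrite vx.
  have tz : t = z by case: (SE t tS) => // tx'; rewrite tx' eqxx in tx.
  move: vS; rewrite !inE -orbA => /or3P[]/eqP vE; subst v.
  - exact: connect0.
  - by apply: connect1; rewrite /fiber_rel rsym rxy !psiS //= pxy.
  - by rewrite -tz in vx; rewrite vx eqxx in tx.
(* Send each vertex of D to a cut vertex of its old fiber: this turns old paths
   within a fiber into new ones. *)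
pose pi v := if v \in D then (if phi v == phi x then x else z) else v.
have outer p q : p \notin D -> q \notin D -> phi p = phi q ->
    connect (fiber_rel r psi) p q.
  move=> pD qD /fib; have {2}-> : p = pi p by rewrite /pi (negPf pD).
  have {2}-> : q = pi q by rewrite /pi (negPf qD).
  have half u v : u \in D -> v \notin D -> r u v -> phi u = phi v ->
      connect (fiber_rel r psi) (pi u) (pi v).
    move=> uD vD ruv uv; have := DE u v uD ruv; rewrite (negPf vD) /= => vS.
    rewrite /pi uD (negPf vD) uv; case: eqP => vx; first by rewrite fsym toX.
    by case: (SE v vS) => // ->.
  apply: connect_map => u v /andP[ruv /eqP uv].
  case: (boolP (u \in D)) => uD; case: (boolP (v \in D)) => vD.
  - by rewrite /pi uD vD uv.
  - exact: half.
  - by rewrite fsym; apply: half; rewrite // rsym.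
  - rewrite /pi (negPf uD) (negPf vD); apply: connect1.
    by rewrite /fiber_rel ruv /psi (negPf uD) (negPf vD) uv eqxx.
split.
- move=> h; have [v vh] := onto h; case: (boolP (v \in D)) => vD.
    have /imsetP[a aS va] := DpS v vD; exists a; by rewrite psiS // -va.
  by exists v; rewrite /psi (negPf vD).
- pose tau v := if v \in D then t else v.
  have tauD v : tau v \notin D by rewrite /tau; case: ifPn => // _; rewrite nDS.
  have toTau v : connect (fiber_rel r psi) v (tau v).
    by rewrite /tau; case: ifP => // vD; apply: reach.
  move=> p q pq; apply: connect_trans (toTau p) _; rewrite fsym.
  apply: connect_trans (toTau q) _; apply: outer => //.
  by move: pq; rewrite /psi /tau; case: ifP; case: ifP.
- move=> h k hk nhk; have [u [v [ruv uh vk]]] := edg _ _ hk nhk.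
  have cross a b : a \in D -> r a b -> phi a != phi b ->
     exists a' b', [/\ r a' b', psi a' = phi a & psi b' = phi b].
    move=> aD rab nab.
    have bpS : phi b \in phi @: S.
      by have /orP[/DpS//|bS] := DE a b aD rab; rewrite imset_f.
    have apS := DpS a aD.
    (* The images of a and b are those of x and z in some order: D joins
       the fiber of one, and sees the cut vertex c in the other. *)
    have [c cS [nct ab]] : exists2 c, c \in S &
       phi c != phi t /\ ((phi a = phi t /\ phi b = phi c) \/
                          (phi a = phi c /\ phi b = phi t)).
      case/imsetP: apS => a' a'S aE; case/imsetP: bpS => b' b'S bE.
      rewrite aE bE in nab *.
      case: (SE a' a'S) (SE b' b'S) (SE t tS) => aE' [] bE' [] tE';
        rewrite ?aE' ?bE' ?tE' ?eqxx // in nab *.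
      - by exists z => //; split; [rewrite eq_sym|left].
      - by exists x => //; split; [|right].
      - by exists z => //; split; [|right].
      - by exists x => //; split; [rewrite eq_sym|left].
    have [e eD ec] := separation_boundary cr sD S3 cS.
    case: ab => [[-> ->]|[-> ->]].
      by exists e, c; rewrite (psiS c) // /psi eD.
    by exists c, e; rewrite rsym (psiS c) // /psi eD.
  case: (boolP (u \in D)) => uD.
    by rewrite -uh -vk; apply: cross => //; rewrite uh vk.
  case: (boolP (v \in D)) => vD.
    have [||b [a [ba bE aE]]] := cross v u vD.
    - by rewrite rsym.
    - by rewrite uh vk eq_sym.
    by exists a, b; rewrite rsym -uh -vk.
  by exists u, v; rewrite /psi (negPf uD) (negPf vD).
Qed.

(** * From multigraphs to adjacency relations *)

Lemma ends_pair (G : mgraph) (e : edge G) u v :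
  u \in ends e -> v \in ends e -> u != v -> ends e = [set u; v].
Proof.
move=> ue ve uv; apply/esym/eqP; rewrite eqEcard cards2 uv.
have /andP[_ ->] := ends_card e; rewrite andbT.
by apply/subsetP => w; rewrite !inE => /orP[]/eqP->.
Qed.

Lemma adjacentI (G : mgraph) (e : edge G) u v :
  u \in ends e -> v \in ends e -> u != v -> adjacent u v.
Proof.
by move=> ue ve uv; apply/existsP; exists e; apply/eqP; exact: ends_pair.
Qed.

Lemma adjacentE (G : mgraph) (u v : vertex G) :
  adjacent u v -> exists2 e : edge G, u \in ends e & v \in ends e.
Proof. by case/existsP => e /eqP ee; exists e; rewrite ee !inE eqxx ?orbT. Qed.

Lemma adjacent_sym (G : mgraph) : symmetric (@adjacent G).
Proof. by move=> u v; rewrite /adjacent setUC. Qed.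

(** The side D is the component of some vertex in the graph without S. *)
Lemma connected_delete_vertices (G : mgraph) (S : {set vertex G}) :
  ~ connected (delete_vertices S) <-> exists D, separation (@adjacent G) D S.
Proof.
have adjS (a b : vertex (delete_vertices S)) : val a != val b ->
    adjacent (val a) (val b) -> adjacent a b.
  move=> nab /existsP[e /eqP eab].
  have dis : [disjoint ends e & S].
    apply/pred0P => v /=; rewrite eab !inE.
    by apply/negP => /andP[/orP[]/eqP-> vS]; [case/negP: (valP a)|case/negP: (valP b)].
  apply: (@adjacentI (delete_vertices S) (Sub e dis));
    by rewrite ?inE ?SubK ?eab ?inE ?eqxx ?orbT.
split=> [nconn|[D [[d dD] [e /andP[eD eS]] DS DE]] conn].
  case: (boolP [forall x, [forall y, connect (@adjacent (delete_vertices S)) x y]]).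
    by move=> /forallP c; case: nconn => x y; exact: (forallP (c x)).
  rewrite negb_forall => /existsP[x]; rewrite negb_forall => /existsP[y xy].
  exists [set val v | v in [set v | connect (@adjacent (delete_vertices S)) x v]]; split.
  - by exists (val x); rewrite imset_f // inE.
  - exists (val y); rewrite (valP y) andbT; apply: contra xy.
    by move=> /imsetP[v + /val_inj->]; rewrite inE.
  - by move=> _ /imsetP[v _ ->]; exact: (valP v).
  - move=> _ v /imsetP[a + ->]; rewrite inE => xa av.
    case: (boolP (v \in S)) => vS; rewrite ?orbT // orbF.
    apply/imsetP; exists (Sub v vS : vertex (delete_vertices S)); rewrite ?SubK // inE.
    have [aE|na] := eqVneq (val a) v.
      by rewrite (_ : Sub v vS = a) //; apply: val_inj.
    by apply: (connect_trans xa); apply: connect1; apply: adjS; rewrite SubK.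
have [x xd] : exists x : vertex (delete_vertices S), val x = d.
  by exists (Sub d (DS d dD)).
have [y ye] : exists y : vertex (delete_vertices S), val y = e by exists (Sub e eS).
have /connectP[p pp yE] := conn x y.
have : val x \in D by rewrite xd.
elim: p x {xd} pp yE => [|a p IHp] x /=; first by move=> _ <-; rewrite ye (negPf eD).
move=> /andP[/adjacentE[g xg ag] pp] yE xD; apply: IHp pp yE _.
have [<-//|nxa] := eqVneq x a.
have /orP[//|aS] : (val a \in D) || (val a \in S).
  apply: DE xD _; apply: (adjacentI (e := val g)).
  - by move: xg; rewrite inE.
  - by move: ag; rewrite inE.
  - by [].
by case/negP: (valP a).
Qed.

Lemma three_connectedP (G : mgraph) : three_connected G <-> conn3 (@adjacent G).
Proof.
split=> -[G4 H]; split=> //.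
  by move=> D S sDS; apply: H; apply/connected_delete_vertices; exists D.
by move=> S /connected_delete_vertices[D]; apply: H.
Qed.

Lemma contract_vertex_eq (G : mgraph) (f : edge G) u v :
  contract_vertex f u = contract_vertex f v ->
  u = v \/ (u \in ends f) && (v \in ends f).
Proof.
rewrite /contract_vertex; case: insubP => [a ua <-|]; case: insubP => [b vb <-|] //.
  by move=> [->]; left.
by rewrite !negbK => -> ->; right.
Qed.

Lemma contract_vertex_end (G : mgraph) (f : edge G) u :
  (contract_vertex f u == None) = (u \in ends f).
Proof.
rewrite /contract_vertex; case: insubP => [a ua _|]; first by rewrite (negPf ua).
by rewrite negbK => ->.
Qed.

Lemma contract_vertexK (G : mgraph) (f : edge G) (a : {v | v \notin ends f}) :
  contract_vertex f (val a) = Some a.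
Proof. exact: valK. Qed.

Lemma contract_vertex_onto (G : mgraph) (f : edge G) a :
  exists v, contract_vertex f v = a.
Proof.
case: a => [a|]; first by exists (val a); rewrite contract_vertexK.
have /andP[/card_gt0P[v vf] _] := ends_card f.
by exists v; apply/eqP; rewrite contract_vertex_end.
Qed.

Lemma contract_weak_hom (G : mgraph) (f : edge G) :
  weak_hom (@adjacent G) (@adjacent (contract f)) (contract_vertex f).
Proof.
move=> u v /adjacentE[e ue ve].
have [->|nuv] := eqVneq (contract_vertex f u) (contract_vertex f v); [by left|right].
have nef : e != f.
  apply: contraNneq nuv => ef; rewrite ef in ue ve.
  by rewrite -contract_vertex_end in ue; rewrite (eqP ue) eq_sym contract_vertex_end.
by apply: (@adjacentI (contract f) (Sub e nef)); rewrite ?imset_f ?SubK.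
Qed.

Lemma contract_model (G : mgraph) (f : edge G) :
  model (@adjacent G) (@adjacent (contract f)) (contract_vertex f).
Proof.
split.
- exact: contract_vertex_onto.
- move=> p q pq; have [pqE|npq] := eqVneq p q; first by rewrite pqE connect0.
  have [pqE|/andP[pf qf]] := contract_vertex_eq pq; first by rewrite pqE eqxx in npq.
  apply: connect1; rewrite /fiber_rel pq eqxx andbT; exact: adjacentI pf qf npq.
- move=> h k /adjacentE[e /imsetP[u ue ->] /imsetP[v ve ->]] nuv.
  exists u, v; split=> //; apply: (adjacentI (e := val e)) => //.
  by apply: contraNneq nuv => ->.
Qed.

(** The edge f may be a loop, which is what allows surplus loops to be
    removed by contraction in model_has_minor. *)
Lemma model_contract (G : mgraph) (U : finType) (s : rel U) (f : edge G) phi :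
  model (@adjacent G) s phi -> {in ends f &, forall u v, phi u = phi v} ->
  exists psi, model (@adjacent (contract f)) s psi.
Proof.
move=> m fE; have /andP[/card_gt0P[p pf] _] := ends_card f.
pose psi (a : vertex (contract f)) := if a is Some v then phi (val v) else phi p.
exists psi; apply: (model_push (@contract_weak_hom G f)); first exact: contract_vertex_onto.
apply: model_eq m; move=> v /=; rewrite /psi /contract_vertex; case: insubP => [a _ -> //|].
by rewrite negbK => vf; apply: fE.
Qed.

(** * Minors as branch maps *)

Lemma delete_weak_hom (G : mgraph) (e : edge G) :
  weak_hom (@adjacent (delete e)) (@adjacent G) id.
Proof.
move=> u v uv; have [->|nuv] := eqVneq u v; [by left|right].
by case/adjacentE: uv => g ug vg; apply: (adjacentI (e := val g)).
Qed.

Lemma minor_model (G M : mgraph) :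
  minor M G -> exists pi, model (@adjacent G) (@adjacent M) pi.
Proof.
elim=> {G} [|G e _ [pi m]|G f _ [pi m]].
- by exists id; split; [move=> h; exists h|move=> p q ->|move=> h k; exists h, k].
- by exists pi; apply: (model_push (@delete_weak_hom G e)) => // a; exists a.
- by exists (pi \o contract_vertex f); apply: model_comp m; apply: contract_model.
Qed.

Lemma isomorphic_model (M H : mgraph) :
  isomorphic M H -> exists phi, model (@adjacent M) (@adjacent H) phi.
Proof.
move=> [fV [fE [[gV fVK gVK] [gE fEK gEK] fVE]]]; exists fV; split.
- by move=> h; exists (gV h).
- by move=> p q /(can_inj fVK)->.
- move=> h k /adjacentE[e]; rewrite -(gEK e) fVE.
  move=> /imsetP[u ue ->] /imsetP[v ve ->] nuv; exists u, v; split=> //.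
  by apply: adjacentI ue ve _; apply: contraNneq nuv => ->.
Qed.

Lemma card_edge_minus (G : mgraph) (e : edge G) :
  #|edge (delete e)|.+1 = #|edge G|.
Proof.
have G_gt0 : 0 < #|edge G| by apply/card_gt0P; exists e.
by rewrite -(prednK G_gt0) -(cardC1 e) card_sub; congr _.+1; apply: eq_card.
Qed.

(** Each edge of H is assigned an edge of G.  While some edge of G lies within a
    fiber, contract it; then phi is a bijection, and the edges that are
    assigned to none of H are deleted. *)
Lemma model_has_minor (G H : mgraph) phi : simple_graph H ->
  model (@adjacent G) (@adjacent H) phi -> has_minor G H.
Proof.
move=> [H2 Hinj]; have [n] := ubnP #|edge G|; elim: n G phi => // n IHn G phi Gn m.
have [onto fib edg] := m.
have /fin_all_exists[psi psiE] (e : edge H) :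
    exists g : edge G, phi @: ends g = ends e.
  have /eqP/cards2P[h [k [nhk ehk]]] := H2 e.
  have hk : adjacent h k by apply/existsP; exists e; rewrite ehk.
  have [u [v [/existsP[g /eqP gE] uh vk]]] := edg _ _ hk nhk.
  by exists g; rewrite gE imsetU1 imset_set1 uh vk ehk.
case: (boolP [exists f : edge G, [forall u in ends f, forall v in ends f, phi u == phi v]]).
  move=> /existsP[f fE].
  have [|chi mchi] := model_contract (f := f) m.
    by move=> u v uf vf; have /forall_inP/(_ u uf)/forall_inP/(_ v vf)/eqP := fE.
  have [|M [MG MH]] := IHn (contract f) chi _ mchi.
    by move: Gn; rewrite -(card_edge_minus f).
  by exists M; split=> //; apply: minor_contract MG.
move=> nconst; have phi_inj : injective phi.
  move=> p q /fib /connectP[[|a l] /=]; first by move=> _ ->.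
  move=> /andP[/andP[/existsP[g /eqP gE] /eqP pa] _] _.
  case/existsP: nconst; exists g; rewrite gE.
  apply/forall_inP => u; rewrite !inE => ua; apply/forall_inP => v; rewrite !inE => va.
  by case/orP: ua => /eqP->; case/orP: va => /eqP->; rewrite ?pa.
have psi_inj : injective psi by move=> a b ab; apply: Hinj; rewrite -!psiE ab.
have phi_bij : bijective phi.
  apply: inj_card_bij => //; rewrite -(card_codom phi_inj).
  apply/subset_leq_card/subsetP => h _; have [v <-] := onto h.
  exact: codom_f.
case: (boolP [exists e : edge G, e \notin codom psi]) => [/existsP[e ne]|].
  have [||M [MG MH]] := IHn (delete e) phi;
    last by exists M; split=> //; apply: minor_delete MG.
  - by move: Gn; rewrite -(card_edge_minus e).
  - split=> //; first by move=> p q /phi_inj->.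
    move=> h k /existsP[g /eqP gE] nhk.
    have npsi : psi g != e by apply: contraNneq ne => <-; apply: codom_f.
    have : h \in ends g /\ k \in ends g by rewrite gE !inE !eqxx orbT.
    rewrite -psiE => -[/imsetP[u ug hu] /imsetP[v vg kv]]; exists u, v; split=> //.
    apply: (@adjacentI (delete e) (Sub (psi g) npsi)) => //.
    by apply: contraNneq nhk => uv; rewrite hu kv uv.
rewrite negb_exists => /forallP all; exists G; split; first exact: minor_refl.
have psi_bij : bijective psi.
  apply: inj_card_bij => //; rewrite -(card_codom psi_inj); apply: subset_leq_card.
  by apply/subsetP => e _; move: (all e); rewrite negbK.
have [ipsi psiK ipsiK] := psi_bij.
exists phi, ipsi; split=> //; first by exists psi.
by move=> e; rewrite -psiE ipsiK.
Qed.

Lemma has_minorP (G H : mgraph) : simple_graph H ->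
  has_minor G H <-> exists phi, model (@adjacent G) (@adjacent H) phi.
Proof.
move=> sH; split=> [[M [/minor_model[pi mpi] /isomorphic_model[phi mphi]]]|[phi]].
  by exists (phi \o pi); apply: model_comp mpi mphi.
exact: model_has_minor.
Qed.

(** Taking for G2 a graph with an edge deleted, the conclusion is the definition
    of a deletable edge; this is how deletability is moved between graphs. *)
Lemma three_connected_minor_bij (G1 G2 H : mgraph) (pi : vertex G1 -> vertex G2) :
  simple_graph H -> bijective pi -> weak_hom (@adjacent G1) (@adjacent G2) pi ->
  three_connected G1 /\ has_minor G1 H -> three_connected G2 /\ has_minor G2 H.
Proof.
move=> sH pib homp [/three_connectedP c1 /(has_minorP _ sH)[phi m1]].
split; first by apply/three_connectedP; exact: conn3_bij pib homp c1.
have [ip piK ipK] := pib; apply/(has_minorP _ sH); exists (phi \o ip).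
apply: (model_push homp) => [a|]; first by exists (ip a).
by apply: model_eq m1 => v /=; rewrite piK.
Qed.

Lemma simple_ends (G : mgraph) (e : edge G) v : simple_graph G -> v \in ends e ->
  exists2 u, v != u & ends e = [set v; u].
Proof.
move=> [G2 _] ve; have /eqP/cards2P[a [b [nab eE]]] := G2 e.
move: ve; rewrite eE !inE => /orP[]/eqP->; first by exists b.
by exists a; rewrite 1?eq_sym // setUC.
Qed.

Lemma simple_contract_neq (G : mgraph) (f : edge G) (e : edge (contract f)) u v :
  simple_graph G -> u \in ends f -> v \in ends f -> u != v ->
  u \in ends (val e) -> v \in ends (val e) -> False.
Proof.
move=> [_ Ginj] uf vf uv ue ve; case/eqP: (valP e); apply: Ginj.
by rewrite (ends_pair uf vf uv) (ends_pair ue ve uv).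
Qed.

Lemma card_contract (G : mgraph) (f : edge G) : simple_graph G ->
  #|vertex (contract f)| = #|vertex G| - 1.
Proof.
move=> [G2 _]; rewrite card_option card_sub.
rewrite (_ : #|_| = #|~: ends f|); last by apply: eq_card => v; rewrite !inE.
by have := cardsC (ends f); rewrite (G2 f); lia.
Qed.

(** An injective branch map exhibits H as a spanning subgraph of G.  An edge of
    G outside H would be deletable, since H itself is 3-connected. *)
Lemma not_injective_model (G H : mgraph) phi :
  simple_graph G -> simple_graph H -> three_connected H ->
  model (@adjacent G) (@adjacent H) phi -> ~ isomorphic G H ->
  (forall e : edge G, ~ deletable H e) -> ~ injective phi.
Proof.
move=> [G2 Ginj] sH cH [onto _ edg] niso nodel inj.
have [H2 Hinj] := sH.
have phiB : bijective phi.
  apply: inj_card_bij => //; rewrite -(card_codom inj); apply: subset_leq_card.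
  by apply/subsetP => h _; have [v <-] := onto h; apply: codom_f.
have [[e noH]|allH] :=
    classic (exists e : edge G, forall h : edge H, ends h <> phi @: ends e).
  apply: (nodel e); have [ip phiK ipK] := phiB.
  apply: (@three_connected_minor_bij H (delete e) H ip sH); first by exists phi.
    move=> h k hk; have [->|nhk] := eqVneq h k; [by left|right].
    have [u [v [/existsP[g /eqP gE] uh vk]]] := edg h k hk nhk.
    have nge : g != e.
      apply/eqP => ge; have /existsP[h' /eqP hE] := hk; apply: (noH h').
      by rewrite -ge gE imsetU1 imset_set1 uh vk hE.
    rewrite -uh -vk !phiK.
    apply: (@adjacentI (delete e) (Sub g nge)); rewrite ?SubK /=.
    - by rewrite /delete_ends /= gE !inE eqxx.
    - by rewrite /delete_ends /= gE !inE eqxx orbT.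
    - by apply: contraNneq nhk => uv; rewrite -uh -vk uv.
  split=> //; exists H; split; first exact: minor_refl.
  exists id, id; split; [by exists id|by exists id|by move=> h; rewrite imset_id].
have /fin_all_exists[fE fEE] (e : edge G) : exists h : edge H, ends h = phi @: ends e.
  by apply: NNPP => no; apply: allH; exists e => h hE; apply: no; exists h.
apply: niso; exists phi, fE; split=> //.
have fEinj : injective fE.
  by move=> a b ab; apply/Ginj/(imset_inj inj); rewrite -!fEE ab.
apply: inj_card_bij => //; rewrite -(card_codom fEinj); apply: subset_leq_card.
apply/subsetP => h _; have /eqP/cards2P[a [b [nab hE]]] := H2 h.
have ab : adjacent a b by apply/existsP; exists h; rewrite hE.
have [u [v [/existsP[g /eqP gE] ua vb]]] := edg a b ab nab.
suff -> : h = fE g by apply: codom_f.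
by apply: Hinj; rewrite fEE gE imsetU1 imset_set1 ua vb hE.
Qed.

(** * An edge whose contraction keeps 3-connectivity and the minor *)

(** The preimage of a cut of G/f of size at most 2 cuts G, so it has at least 3
    vertices; hence the cut contains the merged vertex and the preimage is both
    ends of f and one more vertex. *)
Lemma noncontractible_separation (G : mgraph) (f : edge G) x y :
  simple_graph G -> three_connected G -> 5 <= #|vertex G| ->
  ends f = [set x; y] -> ~ three_connected (contract f) ->
  exists z D, separation (@adjacent G) D [set x; y; z].
Proof.
move=> sG /three_connectedP cG G5 fE nc; apply: NNPP => nsep; case: nc.
apply/three_connectedP; split; first by rewrite (card_contract f sG); lia.
move=> D S sDS; rewrite leqNgt; apply/negP => S2.
have onto := @contract_vertex_onto G f.
have sG' := separation_preim (@contract_weak_hom G f) onto sDS.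
set D' := _ @^-1: D in sG'; set S' := _ @^-1: S in sG'.
have S'3 := cG.2 _ _ sG'.
have cA : #|S' :\: ends f| <= #|S :\ None|.
  rewrite -(card_in_imset (f := contract_vertex f)).
    apply/subset_leq_card/subsetP => _ /imsetP[v + ->].
    by rewrite !inE contract_vertex_end.
  move=> u v; rewrite !inE => /andP[uf _] /andP[vf _] /contract_vertex_eq[//|].
  by rewrite (negPf uf).
have := @cardsD1 (vertex (contract f)) None S; have := cardsID (ends f) S'.
case: (boolP (None \in S)) => NS /= S'E SE; last first.
  have : S' :&: ends f = set0.
    apply/setP => v; rewrite /S' !inE; apply: contraNF NS.
    by rewrite -contract_vertex_end => /andP[+ /eqP vN]; rewrite vN.
  move=> S'0; rewrite S'0 cards0 add0n in S'E; rewrite add0n in SE.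
  by move: S'3; rewrite -S'E => /leq_trans/(_ cA); rewrite -SE leqNgt S2.
have fS : ends f \subset S'.
  by apply/subsetP => v; rewrite /S' inE -contract_vertex_end => /eqP->.
have [G2 _] := sG; have Sf : #|S' :&: ends f| = 2 by rewrite (setIidPr fS).
have /cards1P[z zE] : #|S' :\: ends f| == 1.
  rewrite SE (ltn_add2l 1 _ 2) in S2; rewrite -S'E Sf (leq_add2l 2 1) in S'3.
  by rewrite eqn_leq S'3 andbT; apply: leq_trans cA S2.
case: nsep; exists z, D'; rewrite -fE -zE.
by rewrite -{1}(setIidPr fS) setID.
Qed.

(** Induction on the size of D.  An edge zu with u in D either is as wanted or
    lies in a 3-cut.  One side of that cut avoids x and y, which are adjacent,
    and its intersection with D is nonempty, misses u and is again cut off by the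
    new 3-cut. *)
Lemma contractible_edge_within (G H : mgraph) D x y z :
  simple_graph G -> three_connected G -> 5 <= #|vertex G| ->
  separation (@adjacent G) D [set x; y; z] -> adjacent x y ->
  (forall (e : edge G) d, d \in D -> d \in ends e -> has_minor (contract e) H) ->
  exists f : edge G, three_connected (contract f) /\ has_minor (contract f) H.
Proof.
move=> sG cG G5; have [n] := ubnP #|D|.
elim: n D x y z => // n IHn D x y z Dn sD xy good.
have cr : conn3 (@adjacent G) by apply/three_connectedP.
have card3 (a b c : vertex G) : #|[set a; b; c]| <= 3 by rewrite setUC cardsU1 cards2; lia.
have [_ _ DS DE] := sD.
have [|u uD uz] := separation_boundary (s := z) cr sD (card3 _ _ _).
  by rewrite !inE eqxx orbT.
have /existsP[f /eqP fE] := uz.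
have Hf : has_minor (contract f) H by apply: (good f u uD); rewrite fE !inE eqxx.
have [cf|ncf] := classic (three_connected (contract f)); first by exists f.
have [v [D' sD']] := noncontractible_separation sG cG G5 fE ncf.
have [D1 [sD1 xD1 yD1]] : exists D1, [/\ separation (@adjacent G) D1 [set u; z; v],
    x \notin D1 & y \notin D1].
  have [_ _ _ DE'] := sD'.
  case: (boolP (x \in D')) => xD'.
    exists (~: (D' :|: [set u; z; v])); split.
    - exact: (separation_compl (@adjacent_sym G)).
    - by rewrite !inE xD'.
    - rewrite -in_setC setCK in_setU; exact: DE' xD' xy.
  case: (boolP (y \in D')) => yD'; last by exists D'.
  exists (~: (D' :|: [set u; z; v])); split.
  - exact: (separation_compl (@adjacent_sym G)).
  - rewrite -in_setC setCK in_setU; apply: DE' yD' _; by rewrite adjacent_sym.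
  - by rewrite !inE yD'.
have [_ [e /andP[eD1 eS1]] DS1 DE1] := sD1.
have zD1 : z \notin D1 by apply/negP => /DS1; rewrite !inE eqxx orbT.
(* D1 misses x, y and z, and no edge joins D to the vertices beyond them. *)
have keep a b : a \in D -> b \in D1 -> adjacent a b -> b \in D.
  move=> aD bD1 /(DE a b aD)/orP[//|]; rewrite !inE -orbA => /or3P[]/eqP bE;
    by move: xD1 yD1 zD1; rewrite -bE bD1.
apply: (IHn (D1 :&: D) u z v) => //.
- rewrite -ltnS; apply: leq_trans Dn; rewrite ltnS.
  apply: proper_card; rewrite properE subsetIr /=; apply/subsetPn; exists u => //.
  rewrite inE uD andbT; by apply/negP => /DS1; rewrite !inE eqxx.
- split.
  - have [|d dD1 du] := separation_boundary (s := u) cr sD1 (card3 _ _ _).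
      by rewrite !inE eqxx.
    by exists d; rewrite inE dD1 (keep u d) // adjacent_sym.
  - by exists e; rewrite inE (negPf eD1).
  - by move=> d; rewrite inE => /andP[/DS1].
  - move=> a b; rewrite inE => /andP[aD1 aD] ab.
    have /orP[bD1|->] := DE1 a b aD1 ab; last by rewrite orbT.
    by rewrite inE bD1 (keep a b).
- by move=> g d; rewrite inE => /andP[_]; apply: good.
Qed.

(** Among the edges inside fibers there is one whose contraction keeps the
    minor; if it spoils 3-connectivity, the side of the resulting 3-cut that
    model_side singles out is where contractible_edge_within applies. *)
Lemma contractible_edge (G H : mgraph) phi :
  simple_graph G -> simple_graph H -> three_connected G -> three_connected H ->
  model (@adjacent G) (@adjacent H) phi -> ~ injective phi ->
  exists f : edge G, three_connected (contract f) /\ has_minor (contract f) H.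
Proof.
move=> sG sH cG cH m ninj.
have cr : conn3 (@adjacent G) by apply/three_connectedP.
have cs : conn3 (@adjacent H) by apply/three_connectedP.
have [onto fib _] := m.
(* Contracting an edge must leave at least 4 vertices. *)
have G5 : 5 <= #|vertex G|.
  apply: leq_ltn_trans cH.1 _; rewrite ltnNge; apply/negP => GH; apply: ninj.
  have phiT : [set phi v | v in vertex G] = setT.
    by apply/setP => h; have [v <-] := onto h; rewrite imset_f // inE.
  apply/injectiveP/injectivePn => -[x [y nxy pxy]].
  have : #|phi @: vertex G| < #|vertex G|.
    rewrite ltn_neqAle leq_imset_card andbT; apply/imset_injP => inj.
    by case/eqP: nxy; apply: inj.
  by rewrite phiT cardsT ltnNge GH.
have [x [y [xy pxy]]] : exists x y, adjacent x y /\ phi x = phi y.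
  apply: NNPP => none; apply: ninj => p q /fib /connectP[[|a l] /=]; first by move=> _ ->.
  by move=> /andP[/andP[pa /eqP ppa] _] _; case: none; exists p, a.
have /existsP[f /eqP fE] := xy.
have good psi (e : edge G) d w : ends e = [set d; w] ->
    model (@adjacent G) (@adjacent H) psi -> psi d = psi w -> has_minor (contract e) H.
  move=> eE mpsi dw; have [|chi mchi] := model_contract (f := e) mpsi.
    by move=> u v; rewrite eE !inE => /orP[]/eqP-> /orP[]/eqP->.
  by apply/(has_minorP _ sH); exists chi.
have Hf : has_minor (contract f) H by apply: good fE m pxy.
have [cf|ncf] := classic (three_connected (contract f)); first by exists f.
have [z [D sD]] := noncontractible_separation sG cG G5 fE ncf.
have within D0 : separation (@adjacent G) D0 [set x; y; z] ->
    (forall v, v \in D0 -> phi v \in phi @: [set x; y; z]) ->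
    exists f : edge G, three_connected (contract f) /\ has_minor (contract f) H.
  move=> sD0 D0S; apply: (contractible_edge_within sG cG G5 sD0 xy) => e d dD de.
  have [w ndw eE] := simple_ends sG de.
  have dw : adjacent d w by apply/existsP; exists e; rewrite eE.
  have [psi mpsi pdw] := model_reroute (@adjacent_sym G) cr m sD0 xy pxy D0S dD dw.
  exact: good eE mpsi pdw.
have S2 : #|phi @: [set x; y; z]| <= 2.
  rewrite !imsetU !imset_set1 pxy setUid cards2; by case: (_ != _).
have [DS|ES] := model_side cs m sD S2; first exact: (within D).
apply: (within (~: (D :|: [set x; y; z]))).
  exact: (separation_compl (@adjacent_sym G)).
by move=> v; rewrite inE inE negb_or => /andP[]; apply: ES.
Qed.

(** * Edges that become deletable after a contraction *)

(** Otherwise the neighbours of v would separate it from the rest. *)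
Lemma three_connected_incidence (G : mgraph) (v : vertex G) :
  three_connected G -> 3 <= #|[set e : edge G | v \in ends e]|.
Proof.
move=> /three_connectedP[G4 cG]; set I := [set e | _].
pose S := [set u | (u != v) && adjacent v u].
have SI : #|S| <= #|I|.
  apply: leq_trans (leq_imset_card (@ends G) I).
  rewrite -(card_in_imset (f := fun s => [set v; s])).
    apply/subset_leq_card/subsetP => _ /imsetP[s + ->]; rewrite inE => /andP[_].
    move=> /existsP[e /eqP eE]; apply/imsetP; exists e; rewrite ?eE //.
    by rewrite inE eE !inE eqxx.
  move=> s t; rewrite !inE => /andP[sv _] _ /setP/(_ s).
  by rewrite !inE eqxx orbT (negPf sv) /= => /esym/eqP.
apply: leq_trans SI; rewrite leqNgt; apply/negP => S2.
have vS : v \notin S by rewrite inE eqxx.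
suff /cG : separation (@adjacent G) [set v] S by rewrite leqNgt S2.
split.
- by exists v; rewrite inE.
- apply: NNPP => none; have /subset_leq_card : [set: vertex G] \subset v |: S.
    apply/subsetP => e _; rewrite !in_setU; apply/negPn/negP; rewrite negb_or => eo.
    by case: none; exists e.
  by rewrite cardsT cardsU1 vS; lia.
- by move=> d; rewrite inE => /eqP->.
- move=> u w; rewrite in_set1 => /eqP-> vw; rewrite !inE vw andbT.
  by case: (w == v).
Qed.

Lemma simple_degree (G : mgraph) (v : vertex G) : simple_graph G ->
  degree v = #|[set e : edge G | v \in ends e]|.
Proof.
move=> [G2 _]; rewrite /degree [X in _ + X](_ : _ = 0) ?addn0 //.
apply/eqP; rewrite cards_eq0; apply/eqP/setP => e; rewrite !inE.
by apply/eqP => eE; have := G2 e; rewrite eE cards1.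
Qed.

(** The graph G\e inherits the minor from G/f\e, so it is cut by at most
    two vertices, and e crosses the cut.  That cut does not survive in the 3-connected graph G/f\e,
    so one side is absorbed into the cut: it is a single end of f, whose only
    neighbour outside the cut is the other end of e. *)
Lemma contract_delete_degree3 (G H : mgraph) (f : edge G) (e : edge (contract f)) :
  simple_graph G -> simple_graph H -> three_connected G ->
  ~ deletable H (val e) -> deletable H e ->
  exists w, [/\ w \in ends f, w \in ends (val e) & degree w = 3].
Proof.
move=> sG sH cG nde [c' /(has_minorP _ sH)[phi mphi]].
have cr : conn3 (@adjacent G) by apply/three_connectedP.
have c'r : conn3 (@adjacent (delete e)) by apply/three_connectedP.
set r := @adjacent (delete (val e)).
have rI (g : edge G) u v : g != val e -> u \in ends g -> v \in ends g -> u != v -> r u v.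
  by move=> ge; apply: (@adjacentI (delete (val e)) (Sub g ge)).
have m : model r (@adjacent (delete e)) (contract_vertex f).
  split.
  - exact: contract_vertex_onto.
  - move=> p q pq; have [pqE|npq] := eqVneq p q; first by rewrite pqE connect0.
    have [pqE|/andP[pf qf]] := contract_vertex_eq pq; first by rewrite pqE eqxx in npq.
    apply: connect1; rewrite /fiber_rel pq eqxx andbT.
    by apply: (rI f) => //; rewrite eq_sym; exact: (valP e).
  - move=> h k /adjacentE[g /imsetP[u ug ->] /imsetP[v vg ->]] nuv.
    exists u, v; split=> //; apply: (rI (val (val g))) => //.
      exact: (valP g).
    by apply: contraNneq nuv => ->.
have Hm : has_minor (delete (val e)) H.
  by apply/(has_minorP _ sH); exists (phi \o contract_vertex f); apply: model_comp m mphi.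
have [D [S [sD S2]]] : exists D S, separation r D S /\ #|S| <= 2.
  apply: NNPP => none; apply: nde; split=> //; apply/three_connectedP.
  split; first exact: cG.1.
  move=> D S sD; rewrite leqNgt; apply/negP => S2; case: none; by exists D, S.
have [u [v [uD vD vS [ue ve]]]] : exists u v,
    [/\ u \in D, v \notin D, v \notin S & u \in ends (val e) /\ v \in ends (val e)].
  apply: NNPP => none; move: S2; rewrite leqNgt => /negP; apply; apply: (cr.2 D).
  have [Din Dout DS DE] := sD; split=> // a b aD /adjacentE[g ag bg].
  apply/negPn/negP; rewrite negb_or => /andP[bD bS].
  have [ge|nge] := eqVneq g (val e); first by case: none; exists a, b; rewrite -ge.
  have nab : a != b by apply: contraNneq bD => <-.
  by have := DE a b aD (rI g a b nge ag bg nab); rewrite (negPf bD) (negPf bS).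
have side D0 w : separation r D0 S ->
    (forall d, d \in D0 -> contract_vertex f d \in contract_vertex f @: S) ->
    w \in D0 -> w \in ends (val e) ->
    exists w, [/\ w \in ends f, w \in ends (val e) & degree w = 3].
  move=> [_ _ DS DE] D0S wD we.
  (* A vertex of D0 has the same image as a cut vertex, so these two are the ends
     of f; hence D0 has only one vertex. *)
  have fS d : d \in D0 -> exists2 s, s \in S & (d \in ends f) && (s \in ends f).
    move=> dD; have /imsetP[s sS /contract_vertex_eq[ds|]] := D0S d dD; last by exists s.
    by have := DS d dD; rewrite ds sS.
  have [s sS /andP[wf sf]] := fS w wD.
  have D0w d : d \in D0 -> d = w.
    move=> dD; apply/eqP/negPn/negP => dw; have [_ _ /andP[df _]] := fS d dD.
    move: sf; rewrite (ends_pair df wf dw) !inE => /orP[]/eqP sE;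
      by [have := DS d dD; rewrite -sE sS|have := DS w wD; rewrite -sE sS].
  exists w; split=> //; rewrite (simple_degree _ sG); apply/eqP.
  rewrite eqn_leq three_connected_incidence // andbT.
  rewrite (cardsD1 (val e)) inE we ltnS; apply: leq_trans S2.
  rewrite -(card_imset _ (proj2 sG)).
  apply: leq_trans (leq_imset_card (fun t => [set w; t]) S).
  apply/subset_leq_card/subsetP => _ /imsetP[g + ->]; rewrite !inE => /andP[nge wg].
  have [t nwt gE] := simple_ends sG wg; apply/imsetP; exists t => //.
  have /orP[/D0w tw|//] : (t \in D0) || (t \in S).
    by apply: DE wD _; apply: (rI g) => //; rewrite gE !inE eqxx orbT.
  by rewrite tw eqxx in nwt.
have S2' : #|contract_vertex f @: S| <= 2 by apply: leq_trans (leq_imset_card _ _) S2.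
have [DS|ES] := model_side c'r m sD S2'; first exact: (side D u).
apply: (side (~: (D :|: S)) v) => //.
- exact: (separation_compl (@adjacent_sym _)).
- by move=> d; rewrite inE inE negb_or => /andP[]; apply: ES.
- by rewrite inE inE negb_or vD.
Qed.

(** * Parallel edges created by a contraction *)

Lemma contract_card_ends (G : mgraph) (f : edge G) (e : edge (contract f)) :
  simple_graph G -> #|ends e| = 2.
Proof.
move=> sG; have [v ve] : exists v, v \in ends (val e).
  by have /andP[/card_gt0P] := ends_card (val e).
have [u nvu eE] := simple_ends sG ve.
have -> : ends e = contract_vertex f @: ends (val e) by [].
rewrite eE imsetU1 imset_set1 cards2.
case: eqP => // /contract_vertex_eq[vu|/andP[vf uf]]; first by rewrite vu eqxx in nvu.
by case: (simple_contract_neq sG vf uf nvu ve); rewrite eE !inE eqxx orbT.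
Qed.

(** Two such edges form a triangle with f. *)
Lemma contract_parallel (G : mgraph) (f : edge G) (e1 e2 : edge (contract f)) :
  simple_graph G -> e1 != e2 -> ends e1 = ends e2 ->
  exists x y, [/\ x \in ends f, y \in ends f, x != y,
                  x \in ends (val e1) & y \in ends (val e2)].
Proof.
move=> sG ne12 eqe; have nends : ends (val e1) <> ends (val e2).
  by move=> /(proj2 sG)/val_inj e12; rewrite e12 eqxx in ne12.
have imE : contract_vertex f @: ends (val e1) = contract_vertex f @: ends (val e2) by [].
have [x xe1 xf] : exists2 x, x \in ends (val e1) & x \in ends f.
  apply: NNPP => none; case: nends; apply: (imset_inj (f := id)) => //.
  rewrite !imset_id.
  have sub : ends (val e1) \subset ends (val e2).
    apply/subsetP => v ve; have : contract_vertex f v \in contract_vertex f @: ends (val e2).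
      by rewrite -imE imset_f.
    by move=> /imsetP[w we /contract_vertex_eq[->//|/andP[vf _]]]; case: none; exists v.
  by apply/eqP; rewrite eqEcard sub !(proj1 sG).
have [b nxb e1E] := simple_ends sG xe1.
have : contract_vertex f x \in contract_vertex f @: ends (val e2) by rewrite -imE imset_f.
move=> /imsetP[y ye2 xy].
have yf : y \in ends f by case: (contract_vertex_eq xy) => [<-//|/andP[]].
exists x, y; split=> //; apply/eqP => xyE; subst y; apply: nends.
have be1 : b \in ends (val e1) by rewrite e1E !inE eqxx orbT.
have : contract_vertex f b \in contract_vertex f @: ends (val e2) by rewrite -imE imset_f.
move=> /imsetP[c ce2 /contract_vertex_eq[bc|/andP[bf _]]].
  by rewrite e1E; apply/esym/ends_pair => //; rewrite bc.
by case: (simple_contract_neq sG xf bf nxb xe1 be1).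
Qed.

Lemma delete_parallel_weak_hom (G : mgraph) (e1 e2 : edge G) :
  e1 != e2 -> ends e1 = ends e2 ->
  weak_hom (@adjacent G) (@adjacent (delete e1)) id.
Proof.
move=> ne eE u v uv; have [->|nuv] := eqVneq u v; [by left|right].
case/adjacentE: uv => g ug vg; have [ge1|nge1] := eqVneq g e1; last first.
  exact: (@adjacentI (delete e1) (Sub g nge1)).
rewrite ge1 eE in ug vg; rewrite eq_sym in ne.
exact: (@adjacentI (delete e1) (Sub e2 ne)).
Qed.

Lemma delete_parallel (G H : mgraph) (e1 e2 : edge G) :
  simple_graph H -> e1 != e2 -> ends e1 = ends e2 ->
  three_connected G -> has_minor G H -> deletable H e1.
Proof.
move=> sH ne eE cG mG.
apply: (@three_connected_minor_bij G (delete e1) H id sH _ _ (conj cG mG)).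
  by exists id.
exact: delete_parallel_weak_hom ne eE.
Qed.

Lemma deletable_delete (G H : mgraph) (e : edge G) (e' : edge (delete e)) :
  simple_graph H -> deletable H e' -> deletable H (val e').
Proof.
move=> sH.
apply: (@three_connected_minor_bij (delete e') (delete (val e')) H id sH).
  by exists id.
move=> u v uv; have [->|nuv] := eqVneq u v; [by left|right].
case/adjacentE: uv => g ug vg.
have ng : val (val g) != val e' by rewrite (inj_eq val_inj); exact: (valP g).
exact: (@adjacentI (delete (val e')) (Sub (val (val g)) ng)).
Qed.

(** In the final graph the merged vertex still has three edges.  Together with
    f, e and e' these make six edges at x or y, and f is counted at both. *)
Lemma contract_delete2_degrees (G : mgraph) (f : edge G) (e : edge (contract f))
    (e' : edge (delete e)) x y x1 x2 :
  simple_graph G -> x \in ends f -> y \in ends f -> x != y ->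
  x1 \in ends f -> x1 \in ends (val e) ->
  x2 \in ends f -> x2 \in ends (val (val e')) ->
  three_connected (delete e') -> 7 <= degree x + degree y.
Proof.
move=> sG xf yf nxy x1f x1e x2f x2e c'; rewrite !simple_degree //.
set I := [set g | x \in ends g]; set J := [set g | y \in ends g].
have fE := ends_pair xf yf nxy.
have IJ g z : z \in ends f -> z \in ends g -> g \in I :|: J.
  by rewrite fE !inE => /orP[]/eqP-> ->; rewrite ?orbT.
have := @three_connected_incidence (delete e') None c'.
set K := [set _ | _] => K3.
have KL : #|K| <= #|(I :|: J) :\ f :\ val e :\ val (val e')|.
  rewrite -(card_imset (f := fun g : edge (delete e') => val (val (val g)))); last first.
    by move=> a b /val_inj/val_inj/val_inj.
  apply/subset_leq_card/subsetP => _ /imsetP[g + ->].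
  rewrite inE => /imsetP[v vg /esym/eqP]; rewrite contract_vertex_end => vf.
  rewrite !in_setD1 (IJ _ v vf vg) andbT !(inj_eq val_inj).
  by rewrite (valP g) (valP (val g)) (valP (val (val g))).
have := cardsUI I J.
rewrite [#|I :|: J|](cardsD1 f) (IJ f x) //.
rewrite (cardsD1 (val e)) in_setD1 (valP e) (IJ _ x1) //=.
rewrite (cardsD1 (val (val e'))) !in_setD1 !(inj_eq val_inj).
rewrite (valP e') (valP (val e')) (IJ _ x2) //=.
have IJ1 : 0 < #|I :&: J| by apply/card_gt0P; exists f; rewrite !inE xf yf.
move=> <-; apply: (@leq_add 6 1) => //; exact: leq_trans K3 KL.
Qed.

(** * Deleting a vertex of degree 3 *)

(** The neighbour a loses the edge f and must keep three others. *)
Lemma delete_vertex_degree (G : mgraph) (w a : vertex G) (f : edge G) :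
  simple_graph G -> ends f = [set w; a] -> w != a ->
  three_connected (delete_vertex w) -> 4 <= degree a.
Proof.
move=> sG fE nwa c'; rewrite simple_degree //.
have aw : a \notin [set w] by rewrite inE eq_sym.
have := @three_connected_incidence (delete_vertex w) (Sub a aw) c'.
set K := [set _ | _] => K3.
rewrite (cardsD1 f) inE fE !inE eqxx orbT ltnS; apply: leq_trans K3 _.
rewrite -(card_imset (f := fun g : edge (delete_vertex w) => val g)); last exact: val_inj.
apply/subset_leq_card/subsetP => _ /imsetP[g + ->]; rewrite !inE SubK => ->.
rewrite andbT; apply/eqP => gf; have := valP g.
by rewrite gf fE disjoint_sym disjoints1 !inE eqxx.
Qed.

Lemma delete_vertex_simple (G : mgraph) (w : vertex G) :
  simple_graph G -> simple_graph (delete_vertex w).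
Proof.
move=> [G2 Ginj].
have valE (e : edge (delete_vertex w)) : val @: ends e = ends (val e).
  apply/setP => v; apply/imsetP/idP => [[u + ->]|ve]; first by rewrite inE.
  have vw : v \notin [set w] by rewrite (disjointFr (valP e) ve).
  by exists (Sub v vw); rewrite ?inE SubK.
split=> [e|a b ab]; first by rewrite -(G2 (val e)) -valE card_imset //; exact: val_inj.
by apply/val_inj/Ginj; rewrite -!valE ab.
Qed.

(** Deleting w and contracting the edge f = wa both leave one vertex fewer; this
    identifies a with the merged vertex. *)
Lemma delete_vertex_embed_bij (G : mgraph) (w a : vertex G) (f : edge G) :
  ends f = [set w; a] -> w != a ->
  bijective (fun v : vertex (delete_vertex w) => contract_vertex f (val v)).
Proof.
move=> fE nwa; have notw (v : vertex (delete_vertex w)) : val v != w.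
  by have := valP v; rewrite inE.
have inj : injective (fun v : vertex (delete_vertex w) => contract_vertex f (val v)).
  move=> u v /contract_vertex_eq[/val_inj//|]; rewrite fE !inE.
  rewrite !(negPf (notw _)) /= => /andP[/eqP ua /eqP va].
  exact/val_inj/(etrans ua (esym va)).
apply: inj_card_bij => //; rewrite -(card_codom inj); apply: subset_leq_card.
apply/subsetP => h _; have [v <-] := contract_vertex_onto h.
have [v' [nv'w <-]] : exists v', v' != w /\ contract_vertex f v' = contract_vertex f v.
  have [->|nvw] := eqVneq v w; last by exists v.
  exists a; rewrite eq_sym; split=> //; transitivity (None : option {v | v \notin ends f}).
    by apply/eqP; rewrite contract_vertex_end fE !inE eqxx orbT.
  by apply/esym/eqP; rewrite contract_vertex_end fE !inE eqxx.
have v'S : v' \notin [set w] by rewrite inE.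
exact: (codom_f (fun v : vertex (delete_vertex w) => contract_vertex f (val v)) (Sub v' v'S)).
Qed.

(** When f, e and e' are all the edges at w, the graph G/f\e\e' is G-w. *)
Lemma delete_vertex_transfer (G H : mgraph) (w a : vertex G) (f : edge G)
    (e : edge (contract f)) (e' : edge (delete e)) :
  simple_graph H -> ends f = [set w; a] -> w != a ->
  (forall g : edge G, w \in ends g -> [|| g == f, g == val e | g == val (val e')]) ->
  deletable H e' -> three_connected (delete_vertex w) /\ has_minor (delete_vertex w) H.
Proof.
move=> sH fE nwa inc de'; have [rho kK rK] := delete_vertex_embed_bij fE nwa.
apply: (@three_connected_minor_bij (delete e') (delete_vertex w) H rho sH _ _ de').
  by exists (fun v => contract_vertex f (val v)).
move=> u v /adjacentE[g ug vg]; have [->|nuv] := eqVneq (rho u) (rho v); [by left|right].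
have dis : [disjoint ends (val (val (val g))) & [set w]].
  rewrite disjoint_sym disjoints1; apply/negP => /inc/or3P[].
  - by rewrite (negPf (valP (val (val g)))).
  - by rewrite (inj_eq val_inj) (negPf (valP (val g))).
  - by rewrite !(inj_eq val_inj) (negPf (valP g)).
have lift z : z \in contract_vertex f @: ends (val (val (val g))) ->
    val (rho z) \in ends (val (val (val g))).
  move=> /imsetP[p pg zp]; have : contract_vertex f (val (rho z)) = contract_vertex f p.
    by rewrite -zp rK.
  move=> /contract_vertex_eq[->//|]; rewrite fE !in_set2.
  have := valP (rho z); rewrite in_set1 => /negPf-> /=.
  have -> : (p == w) = false by apply: contraTF pg => /eqP->; rewrite -disjoints1 disjoint_sym.
  by move=> /andP[/eqP-> /eqP<-].
pose g' : edge (delete_vertex w) := exist _ (val (val (val g))) dis.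
have lift' z : z \in contract_vertex f @: ends (val (val (val g))) ->
    rho z \in ends g'.
  by rewrite inE; apply: lift.
exact: (@adjacentI (delete_vertex w) g' _ _ (lift' u ug) (lift' v vg) nuv).
Qed.

(** G/f has all the edges of G-w, so an edge that can be spared in G-w can be
    spared in G/f. *)
Lemma delete_vertex_deletable (G H : mgraph) (w a : vertex G) (f : edge G)
    (e : edge (delete_vertex w)) (nef : val e != f) :
  simple_graph H -> ends f = [set w; a] -> w != a ->
  deletable H e -> deletable H (Sub (val e) nef : edge (contract f)).
Proof.
move=> sH fE nwa.
apply: (@three_connected_minor_bij
          (delete e) (delete (Sub (val e) nef : edge (contract f))) H _ sH
          (delete_vertex_embed_bij fE nwa)).
move=> u v /adjacentE[g ug vg].
have [->|nuv] := eqVneq (contract_vertex f (val u)) (contract_vertex f (val v)).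
  by left.
right.
have ngf : val (val g) != f.
  apply/eqP => gf; have := valP (val g).
  by rewrite gf fE disjoint_sym disjoints1 !inE eqxx.
pose e0 : edge (contract f) := Sub (val e) nef.
pose g0 : edge (contract f) := Sub (val (val g)) ngf.
have nge : g0 != e0 by rewrite -(inj_eq val_inj) !SubK (inj_eq val_inj) (valP g).
pose g' : edge (delete e0) := exist _ g0 nge.
have lift z : z \in ends g -> contract_vertex f (val z) \in ends g'.
  by rewrite inE => zg; apply/imsetP; exists (val z).
exact: (adjacentI (lift u ug) (lift v vg) nuv).
Qed.

Lemma card_delete_vertex (G : mgraph) (w : vertex G) :
  #|vertex (delete_vertex w)| = #|vertex G| - 1.
Proof.
rewrite card_sub (_ : #|_| = #|~: [set w]|); last by apply: eq_card => v; rewrite !inE.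
by have := cardsC [set w]; rewrite cards1; lia.
Qed.

Lemma card_edge_delete_vertex (G : mgraph) (w : vertex G) :
  #|edge (delete_vertex w)| = #|edge G| - #|[set e : edge G | w \in ends e]|.
Proof.
rewrite card_sub (_ : #|_| = #|~: [set e : edge G | w \in ends e]|).
  by have := cardsC [set e : edge G | w \in ends e]; lia.
by apply: eq_card => e; rewrite !inE disjoint_sym disjoints1.
Qed.

(** * The chain theorem *)

Theorem theorem3p1 (G H : mgraph)
  (simpleG : simple_graph G) (simpleH : simple_graph H)
  (connG : three_connected G) (connH : three_connected H)
  (minorGH : has_proper_minor G H)
  (nodelG : forall e : edge G, ~ deletable H e) :
  exists G' : mgraph,
    [/\ simple_graph G', three_connected G', has_minor G' H
      & forall e : edge G', ~ deletable H e] /\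
    [\/ exists f : edge G, G' = contract f,
        exists (w : vertex G) (f : edge G) (e : {x : edge G | x != f}),
          [/\ degree w = 3, w \in ends f, w \in ends (val e)
            & G' = delete (G := contract f) e]
      | exists w : vertex G, degree w = 3 /\ G' = delete_vertex w] /\
    #|vertex G'| = #|vertex G| - 1 /\
    #|edge G| - 3 <= #|edge G'|.
Proof.
have [/(has_minorP _ simpleH)[phi mphi] niso] := minorGH.
have ninj := not_injective_model simpleG simpleH connH mphi niso nodelG.
have [f [cf mf]] := contractible_edge simpleG simpleH connG connH mphi ninj.
have deg3 (e : edge (contract f)) : deletable H e ->
    exists w, [/\ w \in ends f, w \in ends (val e) & degree w = 3].
  exact: contract_delete_degree3.
have cardV := card_contract f simpleG.
have cardE : #|edge (contract f)|.+1 = #|edge G| := card_edge_minus f.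
have cardE2 (e : edge (contract f)) : #|edge G| - 3 <= #|edge (delete e)|.
  by rewrite -cardE -(card_edge_minus e); lia.
have [/injectiveP einj|/injectivePn[e1 [e2 ne12 eqe]]] :=
    boolP (injectiveb (@ends (contract f))); last first.
  have de1 := delete_parallel simpleH ne12 eqe cf mf.
  have de2 : deletable H e2.
    by apply: (delete_parallel (e2 := e1)) => //; rewrite eq_sym.
  have [x [y [xf yf nxy xe1 ye2]]] := contract_parallel simpleG ne12 eqe.
  have fE := ends_pair xf yf nxy.
  have dx : degree x = 3.
    have [w [wf we dw]] := deg3 _ de1; have [<-//|nwx] := eqVneq w x.
    by case: (simple_contract_neq simpleG wf xf nwx we xe1).
  have dy : degree y = 3.
    have [w [wf we dw]] := deg3 _ de2; have [<-//|nwy] := eqVneq w y.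
    by case: (simple_contract_neq simpleG wf yf nwy we ye2).
  have nodel (e' : edge (delete e1)) : ~ deletable H e'.
    move=> de'; have [w [wf we' _]] := deg3 _ (deletable_delete simpleH de').
    have := contract_delete2_degrees simpleG xf yf nxy xf xe1 wf we' de'.1.
    by rewrite dx dy.
  exists (delete e1); split.
    split; [|exact: de1.1|exact: de1.2|exact: nodel].
    split; first by move=> e; apply: (contract_card_ends (val e)).
    move=> a b ab; apply/eqP/negPn/negP => nab.
    exact: (nodel a (delete_parallel simpleH nab ab de1.1 de1.2)).
  split; last by split; [exact: cardV|exact: cardE2].
  by apply: Or32; exists x, f, e1.
have sC : simple_graph (contract f) by split=> // e; apply: contract_card_ends.
have [[e de]|nodel] := classic (exists e : edge (contract f), deletable H e); last first.
  exists (contract f); split.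
    split; [exact: sC|exact: cf|exact: mf|].
    by move=> e de; apply: nodel; exists e.
  split; first by apply: Or31; exists f.
  by split; [exact: cardV|rewrite -cardE; lia].
have [w [wf we dw]] := deg3 e de; have [a nwa fE] := simple_ends simpleG wf.
have af : a \in ends f by rewrite fE !inE eqxx orbT.
have [[e' de']|nodel] := classic (exists e' : edge (delete e), deletable H e'); last first.
  exists (delete e); split.
    split; [|exact: de.1|exact: de.2|by move=> e' de'; apply: nodel; exists e'].
    by split=> [g|a' b' ab]; [apply: (sC.1)|apply/val_inj/einj].
  split; last by split; [exact: cardV|exact: cardE2].
  by apply: Or32; exists w, f, e.
have [w' [w'f w'e' dw']] := deg3 _ (deletable_delete simpleH de').
have w'w : w' = w.
  apply/eqP/negPn/negP => nw'w.
  have := contract_delete2_degrees simpleG w'f wf nw'w wf we w'f w'e' de'.1.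
  by rewrite dw dw'.
subst w'.
have inc (g : edge G) : w \in ends g -> [|| g == f, g == val e | g == val (val e')].
  have : [set f; val e; val (val e')] == [set g | w \in ends g].
    rewrite eqEcard; apply/andP; split.
      by apply/subsetP => h; rewrite !inE -orbA => /or3P[]/eqP->.
    rewrite -simple_degree // dw setUC cardsU1 cards2 !inE.
    rewrite (eq_sym f) (valP e) (negPf (valP (val e'))) (inj_eq val_inj).
    by rewrite (negPf (valP e')).
  by move=> /eqP/setP/(_ g); rewrite !inE -orbA => -> .
have [cw mw] := delete_vertex_transfer simpleH fE nwa inc de'.
exists (delete_vertex w); split.
  split; [exact: delete_vertex_simple|exact: cw|exact: mw|].
  move=> g dg.
  have wg : w \notin ends (val g) by have := valP g; rewrite disjoint_sym disjoints1.
  have ngf : val g != f by apply: contraNneq wg => ->.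
  have [z [zf zg dz]] := deg3 _ (delete_vertex_deletable ngf simpleH fE nwa dg).
  move: zf; rewrite fE !inE => /orP[]/eqP zE; first by case/negP: wg; move: zg; rewrite zE.
  by have := delete_vertex_degree simpleG fE nwa cw; rewrite -zE dz.
split; first by apply: Or33; exists w.
split; first exact: card_delete_vertex.
by rewrite card_edge_delete_vertex -simple_degree // dw.
Qed.
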